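(* Let $\tau>0$ and let $$\mathcal A=\begin{pmatrix}\frac{2}{\tau}M_B & M_BK & 0\\ -K^TM_B & \frac{2}{\tau}M_E+Z & M_EG\\ 0&-G^TM_E&\frac{2}{\tau}M_p\end{pmatrix},$$ $$\mathcal L=\begin{pmatrix}I&0&0\\-\frac{\tau}{2}K^T&I&0\\0&-\frac{\tau}{2}G^T&I\end{pmatrix},\qquad \mathcal U=\begin{pmatrix}I&\frac{\tau}{2}K&0\\0&I&\frac{\tau}{2}G\\0&0&I\end{pmatrix},$$ $$S_E=\tfrac{\tau}{2}K^TM_BK+\tfrac{2}{\tau}M_E+Z,\qquad S_p=\tfrac{\tau}{2}G^TM_EG+\tfrac{2}{\tau}M_p .$$ Let $Q=\mathrm{diag}(Q_B,Q_E,Q_p)$ with $Q_B,Q_E,Q_p$ symmetric positive definite, and define $$\mathcal X_{\mathcal L\mathcal D}:=Q\mathcal L^{-1},\qquad \mathcal X_{\mathcal D\mathcal U}:=\mathcal U^{-1}Q,\qquad \mathcal X_{\mathcal L\mathcal D\mathcal U}:=\mathcal U^{-1}Q\mathcal L^{-1}.$$ Assume that, for positive constants $c_{1,B},c_{2,B},c_{1,E},c_{2,E},c_{1,p},c_{2,p}$ independent of $h$, $\tau$, $\varepsilon$, $\mu^{-1}$, and for all vectors $B,E,p$, $$c_{1,B}\langle Q_BB,B\rangle\le\langle(\tfrac{2}{\tau}M_B)^{-1}B,B\rangle\le c_{2,B}\langle Q_BB,B\rangle,$$ $$c_{1,E}\langle Q_EE,E\rangle\le\langle S_E^{-1}E,E\rangle\le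 c_{2,E}\langle Q_EE,E\rangle,$$ $$c_{1,p}\langle Q_pp,p\rangle\le\langle S_p^{-1}p,p\rangle\le c_{2,p}\langle Q_pp,p\rangle .$$ Then all eigenvalues $\lambda(\cdot)$ of the preconditioned matrices satisfy $$\lambda(\mathcal X_{\mathcal L\mathcal D}\mathcal A)\in[C_1,C_2],\quad\lambda(\mathcal X_{\mathcal D\mathcal U}\mathcal A)\in[C_1,C_2],\quad\lambda(\mathcal X_{\mathcal L\mathcal D\mathcal U}\mathcal A)\in[C_1,C_2],$$ where $C_1=\min\{c_{2,B}^{-1},c_{2,E}^{-1},c_{2,p}^{-1}\}$ and $C_2=\max\{c_{1,B}^{-1},c_{1,E}^{-1},c_{1,p}^{-1}\}$ are constants that depend neither on the discretization parameters $h$ and $\tau$ nor on the physical parameters $\varepsilon$ and $\mu^{-1}$.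
   Context: Setting. $\Omega=\mathcal S\setminus\overline{\mathcal O}\subset\mathbb R^3$ is a bounded Lipschitz domain (polyhedral, meshed by tetrahedra of mesh size $h$), $\mathcal O$ an obstacle inside a large ball $\mathcal S$; $\Gamma_i=\partial\Omega\cap\partial\mathcal O$, $\Gamma_o=\partial\Omega\setminus\Gamma_i$. $\varepsilon,\mu$ are positive continuous functions on $\overline\Omega$; $\gamma$ is a constant with $1+\gamma\ge0$. $H_{h,0}(\mathrm{grad})\subset H_0^1(\Omega)$, $H_{h,\mathrm{imp}}(\mathrm{curl})\subset\{v\in H(\mathrm{curl}):v\wedge n|_{\Gamma_o}=0\}$, $H_{h,\mathrm{imp}}(\mathrm{div})\subset\{v\in H(\mathrm{div}):v\cdot n|_{\Gamma_o}=0\}$ are the Lagrange, Nédélec and Raviart–Thomas finite element spaces of matching order, so that grad and curl map each space into the next. Matrices. $M_p$, $M_E$, $M_B$ are the mass matrices of $H_{h,0}(\mathrm{grad})$ (unweighted $L^2$), $H_{h,\mathrm{imp}}(\mathrm{curl})$ ($\varepsilon$-weighted $L^2$) and $H_{h,\mathrm{imp}}(\mathrm{div})$ ($\mu^{-1}$-weighted $L^2$); all are symmetric positive definite. $Z$ is the symmetric positive semidefinite matrix of the form $(1+\gamma)\int_{\Gamma_i}E_{\mathrm{tan}}\cdot F_{\mathrm{tan}}$ on $H_{h,\mathrm{imp}}(\mathrm{curl})$, where $F_{\mathrm{tan}}=F-(F\cdot n)n$. $G$ and $K$ are the matrices of $\mathrm{grad}:H_{h,0}(\mathrm{grad})\to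 H_{h,\mathrm{imp}}(\mathrm{curl})$ and $\mathrm{curl}:H_{h,\mathrm{imp}}(\mathrm{curl})\to H_{h,\mathrm{imp}}(\mathrm{div})$ in terms of the finite element bases and degrees of freedom; they satisfy $KG=0$ and $G^TZ=0$. $\langle\cdot,\cdot\rangle$ between vectors is the Euclidean pairing. *)

(* Defs.v *)
From HB Require Import structures.
From mathcomp Require Import all_boot all_order all_algebra.
From mathcomp Require Import complex reals.

Set Implicit Arguments.
Unset Strict Implicit.
Unset Printing Implicit Defensive.

Import Order.TTheory GRing.Theory Num.Theory.
Local Open Scope ring_scope.

Section Definitions.
Variable R : realType.

Definition dotv n (u v : 'cV[R]_n) : R := \sum_i u i 0 * v i 0.

Definition is_spd n (M : 'M[R]_n) : Prop :=
  M^T = M /\ (forall x : 'cV[R]_n, x != 0 -> 0 < dotv (M *m x) x).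

Definition is_spsd n (M : 'M[R]_n) : Prop :=
  M^T = M /\ (forall x : 'cV[R]_n, 0 <= dotv (M *m x) x).

Definition spectrally_between n (c1 c2 : R) (Q N : 'M[R]_n) : Prop :=
  forall x : 'cV[R]_n,
    c1 * dotv (Q *m x) x <= dotv (N *m x) x <= c2 * dotv (Q *m x) x.

(* A real matrix may have non-real eigenvalues, so the spectrum is taken in
   R[i]: the predicate also asserts that it is real.  The library's
   [eigenvalue] refers to row vectors, which gives the same spectrum. *)
Definition eigenvalues_in n (M : 'M[R]_n) (a b : R) : Prop :=
  forall lambda : R[i], eigenvalue (map_mx (real_complex R) M) lambda ->
    complex.Im lambda = 0 /\ a <= complex.Re lambda <= b.

Definition block3_mx n1 n2 n3
    (A11 : 'M[R]_n1) (A12 : 'M[R]_(n1, n2)) (A13 : 'M[R]_(n1, n3))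
    (A21 : 'M[R]_(n2, n1)) (A22 : 'M[R]_n2) (A23 : 'M[R]_(n2, n3))
    (A31 : 'M[R]_(n3, n1)) (A32 : 'M[R]_(n3, n2)) (A33 : 'M[R]_n3) :
    'M[R]_(n1 + (n2 + n3)) :=
  block_mx A11 (row_mx A12 A13)
           (col_mx A21 A31) (block_mx A22 A23 A32 A33).

Section System.
Variables (nB nE np : nat) (tau : R).
Variables (MB : 'M[R]_nB) (ME : 'M[R]_nE) (Mp : 'M[R]_np) (Z : 'M[R]_nE).
Variables (K : 'M[R]_(nB, nE)) (G : 'M[R]_(nE, np)).

Definition calA : 'M[R]_(nB + (nE + np)) := block3_mx
  ((2 / tau) *: MB)   (MB *m K)                 0
  (- (K^T *m MB))     ((2 / tau) *: ME + Z)     (ME *m G)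
  0                   (- (G^T *m ME))           ((2 / tau) *: Mp).

Definition calL : 'M[R]_(nB + (nE + np)) := block3_mx
  1%:M                      0                         0
  (- ((tau / 2) *: K^T))    1%:M                      0
  0                         (- ((tau / 2) *: G^T))    1%:M.

Definition calU : 'M[R]_(nB + (nE + np)) := block3_mx
  1%:M    ((tau / 2) *: K)    0
  0       1%:M                ((tau / 2) *: G)
  0       0                   1%:M.

Definition S_E : 'M[R]_nE :=
  (tau / 2) *: (K^T *m MB *m K) + (2 / tau) *: ME + Z.

Definition S_p : 'M[R]_np :=
  (tau / 2) *: (G^T *m ME *m G) + (2 / tau) *: Mp.

Variables (QB : 'M[R]_nB) (QE : 'M[R]_nE) (Qp : 'M[R]_np).

Definition calQ : 'M[R]_(nB + (nE + np)) :=
  block3_mx QB 0 0  0 QE 0  0 0 Qp.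

Definition X_LD : 'M[R]_(nB + (nE + np)) := calQ *m invmx calL.
Definition X_DU : 'M[R]_(nB + (nE + np)) := invmx calU *m calQ.
Definition X_LDU : 'M[R]_(nB + (nE + np)) :=
  invmx calU *m calQ *m invmx calL.

End System.
End Definitions.

(* Main.v *)
Require Import Defs.
From HB Require Import structures.
From mathcomp Require Import all_boot all_order all_algebra.
From mathcomp Require Import complex reals.
From mathcomp Require Import ring lra.

Set Implicit Arguments.
Unset Strict Implicit.
Unset Printing Implicit Defensive.

Import Order.TTheory GRing.Theory Num.Theory.
Local Open Scope ring_scope.

(* With [D = diag((2/tau) MB, S_E, S_p)] the relations [K G = 0] and [G^T Z = 0]
   give [A = L D U] exactly.  Hence [X_LD A = Q D U] is block upper triangular,
   [X_DU A] is similar to the block lower triangular [Q L D], and [X_LDU A] is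
   similar to [Q D]; each has the eigenvalues of the three diagonal blocks
   [Q_i D_i].  A left eigenvector [v] of [Q_i D_i] satisfies
   [v Q_i = lambda v D_i^-1], so [lambda] is the ratio of the Hermitian forms of
   [Q_i] and [D_i^-1] at [v], which the spectral equivalence controls. *)

Lemma block3_mulmx (R : realType) n1 n2 n3
    (A11 B11 : 'M[R]_n1) (A12 B12 : 'M[R]_(n1, n2)) (A13 B13 : 'M[R]_(n1, n3))
    (A21 B21 : 'M[R]_(n2, n1)) (A22 B22 : 'M[R]_n2) (A23 B23 : 'M[R]_(n2, n3))
    (A31 B31 : 'M[R]_(n3, n1)) (A32 B32 : 'M[R]_(n3, n2)) (A33 B33 : 'M[R]_n3) :
  block3_mx A11 A12 A13 A21 A22 A23 A31 A32 A33 *m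
  block3_mx B11 B12 B13 B21 B22 B23 B31 B32 B33 =
  block3_mx
    (A11 *m B11 + A12 *m B21 + A13 *m B31)
    (A11 *m B12 + A12 *m B22 + A13 *m B32)
    (A11 *m B13 + A12 *m B23 + A13 *m B33)
    (A21 *m B11 + A22 *m B21 + A23 *m B31)
    (A21 *m B12 + A22 *m B22 + A23 *m B32)
    (A21 *m B13 + A22 *m B23 + A23 *m B33)
    (A31 *m B11 + A32 *m B21 + A33 *m B31)
    (A31 *m B12 + A32 *m B22 + A33 *m B32)
    (A31 *m B13 + A32 *m B23 + A33 *m B33).
Proof.
rewrite /block3_mx mulmx_block mul_row_col mul_mx_row mul_row_block add_row_mx.
rewrite mul_col_mx mul_block_col add_col_mx mul_col_row mulmx_block.
by rewrite add_block_mx !addrA.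
Qed.

(** * Spectra of block triangular and similar matrices *)

Section Eigenvalues.
Variable R : realType.

(** Split a left eigenvector as [(l, r)]. The first block column reads [l A = lambda l], so [A] owns
    the eigenvalue unless [l = 0]; in that case [r] is nonzero and is an eigenvector of [D]. *)
Lemma eigenvalues_in_ublock m n (A : 'M[R]_m) (B : 'M[R]_(m, n))
    (D : 'M[R]_n) a b :
  eigenvalues_in A a b -> eigenvalues_in D a b ->
  eigenvalues_in (block_mx A B 0 D) a b.
Proof.
move=> hA hD l /eigenvalueP[v]; rewrite map_block_mx map_mx0 -[v]hsubmxK.
rewrite mul_row_block mulmx0 addr0 scale_row_mx => /eq_row_mx[hl hr] v0.
case: (eqVneq (lsubmx v) 0) => [l0|lN0]; last first.
  by apply: hA; apply/eigenvalueP; exists (lsubmx v).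
apply: hD; apply/eigenvalueP; exists (rsubmx v).
  by rewrite -hr l0 mul0mx add0r.
by apply: contraNneq v0 => r0; rewrite l0 r0 row_mx0.
Qed.

(** Mirror image of the upper case: the last block column is now the decoupled one, so the case
    split is on the right part. *)
Lemma eigenvalues_in_lblock m n (A : 'M[R]_m) (C : 'M[R]_(n, m))
    (D : 'M[R]_n) a b :
  eigenvalues_in A a b -> eigenvalues_in D a b ->
  eigenvalues_in (block_mx A 0 C D) a b.
Proof.
move=> hA hD l /eigenvalueP[v]; rewrite map_block_mx map_mx0 -[v]hsubmxK.
rewrite mul_row_block mulmx0 add0r scale_row_mx => /eq_row_mx[hl hr] v0.
case: (eqVneq (rsubmx v) 0) => [r0|rN0]; last first.
  by apply: hD; apply/eigenvalueP; exists (rsubmx v).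
apply: hA; apply/eigenvalueP; exists (lsubmx v).
  by rewrite -hl r0 mul0mx addr0.
by apply: contraNneq v0 => l0; rewrite l0 r0 row_mx0.
Qed.

Lemma eigenvalues_in_similar n (V M : 'M[R]_n) a b : V \in unitmx ->
  eigenvalues_in M a b -> eigenvalues_in (invmx V *m M *m V) a b.
Proof.
move=> Vu hM l /eigenvalueP[v hv v0]; apply: hM; apply/eigenvalueP.
have Wu : map_mx (real_complex R) V \in unitmx by rewrite map_unitmx.
(* A left eigenvector [v] of [V^-1 M V] is carried to the left eigenvector [v V^-1] of [M]. *)
exists (v *m invmx (map_mx (real_complex R) V)); last first.
  apply: contraNneq v0 => w0.
  by rewrite -(mulmxKV Wu v) w0 mul0mx.
rewrite !map_mxM map_invmx !mulmxA in hv.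
by rewrite scalemxAl -hv mulmxK.
Qed.

Lemma eigenvalues_in_widen n (M : 'M[R]_n) a b a' b' : a' <= a -> b <= b' ->
  eigenvalues_in M a b -> eigenvalues_in M a' b'.
Proof.
move=> ha hb hM l /hM[-> /andP[al lb]]; split=> //.
by rewrite (le_trans ha al) (le_trans lb hb).
Qed.

(** * Quadratic forms and definiteness *)

Lemma dotvE n (M : 'M[R]_n) (x : 'cV[R]_n) :
  dotv (M *m x) x = (x^T *m M *m x) 0 0.
Proof.
rewrite -mulmxA [RHS]mxE; apply: eq_bigr => i _.
by rewrite [x^T _ _]mxE mulrC.
Qed.

Lemma dotvDl n (x y z : 'cV[R]_n) : dotv (x + y) z = dotv x z + dotv y z.
Proof. by rewrite -big_split; apply: eq_bigr => i _; rewrite mxE mulrDl. Qed.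

Lemma dotvZl n k (x z : 'cV[R]_n) : dotv (k *: x) z = k * dotv x z.
Proof. by rewrite mulr_sumr; apply: eq_bigr => i _; rewrite mxE mulrA. Qed.

Lemma dotv_congr m n (M : 'M[R]_m) (P : 'M[R]_(m, n)) (x : 'cV[R]_n) :
  dotv (P^T *m M *m P *m x) x = dotv (M *m (P *m x)) (P *m x).
Proof. by rewrite !dotvE trmx_mul !mulmxA. Qed.

Lemma is_spd_spsd n (M : 'M[R]_n) : is_spd M -> is_spsd M.
Proof.
case=> sM pM; split=> // x; have [->|/pM/ltW//] := eqVneq x 0.
by rewrite /dotv big1 // => i _; rewrite [X in _ * X]mxE mulr0.
Qed.

Lemma is_spd_scale n k (M : 'M[R]_n) : 0 < k -> is_spd M -> is_spd (k *: M).
Proof.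
move=> k0 [sM pM]; split=> [|x /pM xM]; first by rewrite linearZ /= sM.
by rewrite -scalemxAl dotvZl mulr_gt0.
Qed.

Lemma is_spsd_scale n k (M : 'M[R]_n) : 0 <= k -> is_spsd M -> is_spsd (k *: M).
Proof.
move=> k0 [sM pM]; split=> [|x]; first by rewrite linearZ /= sM.
by rewrite -scalemxAl dotvZl mulr_ge0.
Qed.

Lemma is_spsd_congr m n (M : 'M[R]_m) (P : 'M[R]_(m, n)) :
  is_spsd M -> is_spsd (P^T *m M *m P).
Proof.
move=> [sM pM]; split=> [|x]; last by rewrite dotv_congr.
by rewrite !trmx_mul trmxK sM mulmxA.
Qed.

Lemma is_spd_addr n (M N : 'M[R]_n) : is_spd M -> is_spsd N -> is_spd (M + N).
Proof.
move=> [sM pM] [sN pN]; split=> [|x /pM xM]; first by rewrite linearD /= sM sN.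
by rewrite mulmxDl dotvDl ltr_pwDl.
Qed.

(** The quadratic form vanishes at any vector of the left kernel, so definiteness makes that kernel
    trivial. *)
Lemma is_spd_unitmx n (M : 'M[R]_n) : is_spd M -> M \in unitmx.
Proof.
move=> [sM pM]; rewrite -row_free_unit -kermx_eq0; apply/rowV0P => v.
move/sub_kermxP => vM; apply/eqP/contraT => v0.
have /pM : v^T != 0 by rewrite trmx_eq0.
by rewrite dotvE trmxK vM mul0mx mxE ltxx.
Qed.

(** * Eigenvalues of a product of two positive definite matrices *)

Lemma map_mx_Re_mulr m n (v : 'M[R[i]]_(m, n)) p (M : 'M[R]_(n, p)) :
  map_mx (@complex.Re R) (v *m map_mx (real_complex R) M)
  = map_mx (@complex.Re R) v *m M.
Proof.
apply/matrixP => i j; rewrite !mxE raddf_sum; apply: eq_bigr => k _ /=.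
by rewrite !mxE; case: (v i k) => a b /=; rewrite mulr0 subr0.
Qed.

Lemma map_mx_Im_mulr m n (v : 'M[R[i]]_(m, n)) p (M : 'M[R]_(n, p)) :
  map_mx (@complex.Im R) (v *m map_mx (real_complex R) M)
  = map_mx (@complex.Im R) v *m M.
Proof.
apply/matrixP => i j; rewrite !mxE raddf_sum; apply: eq_bigr => k _ /=.
by rewrite !mxE; case: (v i k) => a b /=; rewrite mulr0 add0r.
Qed.

(** Both sides are entries of one-by-one matrices that are transposes of each other. *)
Lemma sym_bilinC n (M : 'M[R]_n) (a b : 'rV[R]_n) : M^T = M ->
  (a *m M *m b^T) 0 0 = (b *m M *m a^T) 0 0.
Proof.
move=> sM; rewrite -[in LHS](trmxK (a *m M *m b^T)) mxE.
by rewrite !trmx_mul trmxK sM mulmxA.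
Qed.

(** Instead of Hermitian forms, the proof uses the real and imaginary parts [a], [b] of the
    eigenvector: the Hermitian form of a real symmetric matrix at [v] is the sum of its real forms
    at [a] and [b]. *)
Lemma eigenvalues_in_spd_mul n c1 c2 (Q N : 'M[R]_n) : 0 < c1 -> 0 < c2 ->
  is_spd Q -> is_spd N -> spectrally_between c1 c2 Q (invmx N) ->
  eigenvalues_in (Q *m N) c2^-1 c1^-1.
Proof.
move=> c1_gt0 c2_gt0 [sQ pQ] hN hQN l /eigenvalueP[v hv v0].
have Nu := is_spd_unitmx hN.
set P := invmx N in hQN; have sP : P^T = P by rewrite trmx_inv hN.1.
have {}hv : v *m map_mx (real_complex R) Q
          = l *: (v *m map_mx (real_complex R) P).
  rewrite scalemxAl -hv map_mxM -!mulmxA -[X in _ *m (_ *m X)]map_mxM.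
  by rewrite mulmxV // map_mx1 mulmx1.
have ReM (z w : R[i]) : complex.Re (z * w)
    = complex.Re z * complex.Re w - complex.Im z * complex.Im w.
  by case: z w => ? ? [].
have ImM (z w : R[i]) : complex.Im (z * w)
    = complex.Re z * complex.Im w + complex.Im z * complex.Re w.
  by case: z w => ? ? [].
set a := map_mx (@complex.Re R) v; set b := map_mx (@complex.Im R) v.
set x := complex.Re l; set y := complex.Im l.
have ha : a *m Q = x *: (a *m P) - y *: (b *m P).
  rewrite -map_mx_Re_mulr hv -[a *m P]map_mx_Re_mulr -[b *m P]map_mx_Im_mulr.
  by apply/matrixP => i j; rewrite ![in LHS]mxE ReM !mxE.
have hb : b *m Q = x *: (b *m P) + y *: (a *m P).
  rewrite -map_mx_Im_mulr hv -[a *m P]map_mx_Re_mulr -[b *m P]map_mx_Im_mulr.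
  by apply/matrixP => i j; rewrite ![in LHS]mxE ImM !mxE.
pose f (M : 'M[R]_n) (s t : 'rV[R]_n) := (s *m M *m t^T) 0 0.
have fa t : f Q a t = x * f P a t - y * f P b t.
  by rewrite /f ha mulmxBl -!scalemxAl !mxE.
have fb t : f Q b t = x * f P b t + y * f P a t.
  by rewrite /f hb mulmxDl -!scalemxAl !mxE.
have Qge s : 0 <= f Q s s.
  by rewrite /f -{1}[s]trmxK -dotvE (is_spd_spsd (conj sQ pQ)).2.
have Qgt s : s != 0 -> 0 < f Q s s.
  by move=> s0; rewrite /f -{1}[s]trmxK -dotvE pQ ?trmx_eq0.
have bnd s : c1 * f Q s s <= f P s s <= c2 * f Q s s.
  by have := hQN s^T; rewrite !dotvE trmxK.
(* Since [v] is nonzero, [a] and [b] cannot both vanish. *)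
have q_gt0 : 0 < f Q a a + f Q b b.
  have [a0|/Qgt] := eqVneq a 0; last by move=> ?; rewrite ltr_pwDl.
  have [b0|/Qgt] := eqVneq b 0; last by move=> ?; rewrite ltr_wpDl.
  case/eqP: v0; apply/matrixP => i j.
  move/matrixP/(_ i j): a0; move/matrixP/(_ i j): b0; rewrite !mxE.
  by case: (v i j) => ? ? /= -> ->.
have /andP[lea leA] := bnd a; have /andP[leb leB] := bnd b.
(* Positivity is inherited from [q_gt0] through the lower spectral bound, as [c1 > 0]. *)
have n_gt0 : 0 < f P a a + f P b b.
  apply: lt_le_trans (lerD lea leb); by rewrite -mulrDr mulr_gt0.
have Pab : f P a b = f P b a by exact: sym_bilinC.
have Qab : f Q a b = f Q b a by exact: sym_bilinC.
(* Equate [f Q a b] and [f Q b a] and expand by [fa] and [fb]: the [x] terms cancel by symmetry of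
   [P], leaving [y] times a positive number. *)
have y0 : y = 0.
  have : y * (f P a a + f P b b) = 0.
    by rewrite fa fb Pab in Qab; lra.
  by move/eqP; rewrite mulf_eq0 (gt_eqF n_gt0) orbF => /eqP.
have qE : f Q a a + f Q b b = x * (f P a a + f P b b).
  by rewrite fa fb y0; ring.
(* Multiplying by the positive denominator reduces both bounds to the sum of the inequalities
   [bnd a] and [bnd b]. *)
split=> //; apply/andP; split.
  rewrite -(ler_pM2r n_gt0) -qE ler_pdivrMl // mulrDr; exact: lerD.
rewrite -(ler_pM2r n_gt0) -qE ler_pdivlMl // mulrDr; exact: lerD.
Qed.

Lemma eigenvalues_in_ublock3 n1 n2 n3 (A11 : 'M[R]_n1) (A12 : 'M[R]_(n1, n2))
    (A13 : 'M[R]_(n1, n3)) (A22 : 'M[R]_n2) (A23 : 'M[R]_(n2, n3))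
    (A33 : 'M[R]_n3) a b :
  eigenvalues_in A11 a b -> eigenvalues_in A22 a b -> eigenvalues_in A33 a b ->
  eigenvalues_in (block3_mx A11 A12 A13 0 A22 A23 0 0 A33) a b.
Proof.
move=> h1 h2 h3; rewrite /block3_mx col_mx0;
apply: eigenvalues_in_ublock => //; exact: eigenvalues_in_ublock.
Qed.

Lemma eigenvalues_in_lblock3 n1 n2 n3 (A11 : 'M[R]_n1) (A21 : 'M[R]_(n2, n1))
    (A22 : 'M[R]_n2) (A31 : 'M[R]_(n3, n1)) (A32 : 'M[R]_(n3, n2))
    (A33 : 'M[R]_n3) a b :
  eigenvalues_in A11 a b -> eigenvalues_in A22 a b -> eigenvalues_in A33 a b ->
  eigenvalues_in (block3_mx A11 0 0 A21 A22 0 A31 A32 A33) a b.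
Proof.
move=> h1 h2 h3; rewrite /block3_mx row_mx0;
apply: eigenvalues_in_lblock => //; exact: eigenvalues_in_lblock.
Qed.

End Eigenvalues.

(** * Block LDU factorization of the system matrix *)

Section Factorization.
Variables (R : realType) (nB nE np : nat) (tau : R).
Variables (MB : 'M[R]_nB) (ME : 'M[R]_nE) (Mp : 'M[R]_np) (Z : 'M[R]_nE).
Variables (K : 'M[R]_(nB, nE)) (G : 'M[R]_(nE, np)).
Hypothesis tau_gt0 : 0 < tau.

Lemma calL_unitmx : calL tau K G \in unitmx.
Proof.
by rewrite unitmxE /calL /block3_mx row_mx0 !det_lblock !det1 !mulr1 unitr1.
Qed.

Lemma calU_unitmx : calU tau K G \in unitmx.
Proof.
by rewrite unitmxE /calU /block3_mx col_mx0 !det_ublock !det1 !mulr1 unitr1.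
Qed.

Lemma S_E_spd : is_spd MB -> is_spd ME -> is_spsd Z -> is_spd (S_E tau MB ME Z K).
Proof.
(* The mass term is moved to the front: it alone supplies definiteness, the other two terms being
   semidefinite. *)
move=> hMB hME hZ; rewrite /S_E [X in X + Z]addrC -addrA.
have tau2_ge0 : 0 <= tau / 2 by rewrite divr_ge0 // ltW.
apply: is_spd_addr; first by apply: is_spd_scale => //; rewrite divr_gt0.
have [sK pK] := is_spsd_scale tau2_ge0 (is_spsd_congr K (is_spd_spsd hMB)).
have [sZ pZ] := hZ; split=> [|x]; first by rewrite linearD /= sK sZ.
by rewrite mulmxDl dotvDl addr_ge0.
Qed.

Lemma S_p_spd : is_spd ME -> is_spd Mp -> is_spd (S_p tau ME Mp G).
Proof.
move=> hME hMp; rewrite /S_p addrC.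
have tau2_ge0 : 0 <= tau / 2 by rewrite divr_ge0 // ltW.
apply: is_spd_addr; first by apply: is_spd_scale => //; rewrite divr_gt0.
exact/is_spsd_scale/is_spsd_congr/is_spd_spsd.
Qed.

(** These are the pivots of block Gaussian elimination on [calA]. The last Schur complement reduces
    to [S_p] because [S_E G = (2/tau) ME G] when [K G = 0] and [Z G = 0]. *)
Definition calD : 'M[R]_(nB + (nE + np)) :=
  block3_mx ((2 / tau) *: MB) 0 0  0 (S_E tau MB ME Z K) 0
            0 0 (S_p tau ME Mp G).

Lemma calA_factor : Z^T = Z -> K *m G = 0 -> G^T *m Z = 0 ->
  calA tau MB ME Mp Z K G = calL tau K G *m calD *m calU tau K G.
Proof.
move=> sZ hKG hGZ.
have hGK : G^T *m K^T = 0 by rewrite -trmx_mul hKG trmx0.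
have hZG : Z *m G = 0 by rewrite -[Z]sZ -[G]trmxK -trmx_mul hGZ trmx0.
have t1 : tau / 2 * (2 / tau) = 1 by field; rewrite gt_eqF.
have t2 : 2 / tau * (tau / 2) = 1 by field; rewrite gt_eqF.
have SEG : S_E tau MB ME Z K *m ((tau / 2) *: G) = ME *m G.
  rewrite /S_E -scalemxAr !mulmxDl hZG addr0 -!scalemxAl -!mulmxA hKG !mulmx0.
  by rewrite scaler0 add0r scalerA t1 scale1r.
have GSE : - ((tau / 2) *: G^T) *m S_E tau MB ME Z K = - (G^T *m ME).
  rewrite /S_E mulNmx -scalemxAl !mulmxDr hGZ addr0 -!scalemxAr !mulmxA hGK.
  by rewrite !mul0mx scaler0 add0r scalerA t1 scale1r.
have KMB : - ((tau / 2) *: K^T) *m ((2 / tau) *: MB) = - (K^T *m MB).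
  by rewrite mulNmx -scalemxAr -scalemxAl scalerA t2 scale1r.
rewrite /calL /calD /calU /calA !block3_mulmx.
rewrite !(mul0mx, mulmx0, mul1mx, mulmx1, addr0, add0r) SEG GSE KMB.
(* Three blocks remain: (1,2) is a cancellation of scalars, while in (2,2) and (3,3) the elimination
   update cancels the first term of [S_E] and of [S_p]. *)
congr block3_mx.
- by rewrite -scalemxAr -scalemxAl scalerA t1 scale1r.
- by rewrite mulNmx -scalemxAr /S_E -!addrA addKr.
- by rewrite mulNmx -scalemxAr /S_p addKr.
Qed.

End Factorization.

(* [I] indexes the choices of the discretization and physical parameters
   (h, tau, eps, mu, ...): the dimensions, the matrices, tau and the blocks of Q
   all depend on [i : I], while the constants c1, c2 do not. *)
Theorem theorem4p4 (R : realType)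
  (c1B c2B c1E c2E c1p c2p : R)
  (hc1B : 0 < c1B) (hc2B : 0 < c2B)
  (hc1E : 0 < c1E) (hc2E : 0 < c2E)
  (hc1p : 0 < c1p) (hc2p : 0 < c2p)
  (I : Type) (nB nE np : I -> nat)
  (tau : I -> R) (htau : forall i, 0 < tau i)
  (MB : forall i, 'M[R]_(nB i)) (ME : forall i, 'M[R]_(nE i))
  (Mp : forall i, 'M[R]_(np i)) (Z : forall i, 'M[R]_(nE i))
  (K : forall i, 'M[R]_(nB i, nE i)) (G : forall i, 'M[R]_(nE i, np i))
  (hMB : forall i, is_spd (MB i)) (hME : forall i, is_spd (ME i))
  (hMp : forall i, is_spd (Mp i)) (hZ : forall i, is_spsd (Z i))
  (hKG : forall i, K i *m G i = 0) (hGZ : forall i, (G i)^T *m Z i = 0)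
  (QB : forall i, 'M[R]_(nB i)) (QE : forall i, 'M[R]_(nE i))
  (Qp : forall i, 'M[R]_(np i))
  (hQB : forall i, is_spd (QB i)) (hQE : forall i, is_spd (QE i))
  (hQp : forall i, is_spd (Qp i))
  (hB : forall i, spectrally_between c1B c2B (QB i)
          (invmx ((2 / tau i) *: MB i)))
  (hE : forall i, spectrally_between c1E c2E (QE i)
          (invmx (S_E (tau i) (MB i) (ME i) (Z i) (K i))))
  (hp : forall i, spectrally_between c1p c2p (Qp i)
          (invmx (S_p (tau i) (ME i) (Mp i) (G i)))) :
  let C1 := Num.min c2B^-1 (Num.min c2E^-1 c2p^-1) in
  let C2 := Num.max c1B^-1 (Num.max c1E^-1 c1p^-1) in
  forall i : I,
    let A := calA (tau i) (MB i) (ME i) (Mp i) (Z i) (K i) (G i) in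
    [/\ eigenvalues_in (X_LD (tau i) (K i) (G i) (QB i) (QE i) (Qp i) *m A)
          C1 C2,
        eigenvalues_in (X_DU (tau i) (K i) (G i) (QB i) (QE i) (Qp i) *m A)
          C1 C2
      & eigenvalues_in (X_LDU (tau i) (K i) (G i) (QB i) (QE i) (Qp i) *m A)
          C1 C2].
Proof.
move=> C1 C2 i A.
(* Each diagonal block has its own interval [[c2^-1, c1^-1]]; [C1] and [C2] are the extreme
   endpoints, so all three widen to [[C1, C2]]. *)
have hD : [/\ eigenvalues_in (QB i *m ((2 / tau i) *: MB i)) C1 C2,
    eigenvalues_in (QE i *m S_E (tau i) (MB i) (ME i) (Z i) (K i)) C1 C2
  & eigenvalues_in (Qp i *m S_p (tau i) (ME i) (Mp i) (G i)) C1 C2].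
  split.
  - have := eigenvalues_in_spd_mul hc1B hc2B (hQB i) _ (hB i).
    move/(_ (is_spd_scale (divr_gt0 (ltr0Sn R 1) (htau i)) (hMB i))).
    by apply: eigenvalues_in_widen; rewrite ?ge_min ?le_max lexx.
  - have := eigenvalues_in_spd_mul hc1E hc2E (hQE i) _ (hE i).
    move/(_ (S_E_spd (K i) (htau i) (hMB i) (hME i) (hZ i))).
    by apply: eigenvalues_in_widen; rewrite ?ge_min ?le_max lexx ?orbT.
  - have := eigenvalues_in_spd_mul hc1p hc2p (hQp i) _ (hp i).
    move/(_ (S_p_spd (G i) (htau i) (hME i) (hMp i))).
    by apply: eigenvalues_in_widen; rewrite ?ge_min ?le_max lexx ?orbT.
have [hDB hDE hDp] := hD.
have AE : A = _ := calA_factor (MB i) (ME i) (Mp i) (htau i) (hZ i).1 (hKG i) (hGZ i).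
have Lu := calL_unitmx (tau i) (K i) (G i).
have Uu := calU_unitmx (tau i) (K i) (G i).
rewrite AE; split.
- rewrite /X_LD -!mulmxA mulKmx // /calQ /calD /calU !block3_mulmx.
  rewrite !(mul0mx, mulmx0, mul1mx, mulmx1, addr0, add0r).
  exact: eigenvalues_in_ublock3.
(* Regrouping exposes conjugation by [calU], with [Q L D] in the middle. *)
- rewrite /X_DU !mulmxA; rewrite -(mulmxA (invmx _)) -(mulmxA (invmx _)).
  apply: eigenvalues_in_similar => //.
  rewrite /calQ /calL /calD !block3_mulmx.
  rewrite !(mul0mx, mulmx0, mul1mx, mulmx1, addr0, add0r).
  exact: eigenvalues_in_lblock3.
- rewrite /X_LDU !mulmxA (mulmxKV Lu) -(mulmxA (invmx _) (calQ _ _ _)).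
  apply: eigenvalues_in_similar => //.
  rewrite /calQ /calD !block3_mulmx.
  rewrite !(mul0mx, mulmx0, mul1mx, mulmx1, addr0, add0r).
  (* The block diagonal [Q D] is the lower triangular case with zero blocks below the diagonal. *)
  exact: eigenvalues_in_lblock3.
Qed.
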